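(* Let $R$ be a commutative unital integral domain with $\mathrm{char}(R)=p>0$, let $H$ be a Hopf algebra over $R$, and let $\Pi\subset\Gamma_H$ be a finite subgroup of weights. Let $\Pi_p$ be any (fixed) $p$-Sylow subgroup of $\Pi$, and let $h_1,\dots,h_n\in H$ ($n\ge1$) be pseudo-primitive with respect to $\Pi$, with $\Delta(h_i)=g_i\otimes h_i+h_i\otimes g_i'$. Let $\mathbf h=\prod_ih_i$, $\mathbf g=\prod_i g_i$, let $\pi:\Pi\twoheadrightarrow\Phi:=\Pi/[\Pi,\Pi]$ be the quotient map, let $\Phi_p$ be the $p$-Sylow subgroup of $\Phi$, and $\Phi'$ a subgroup of $\Phi$ of order $|\Phi|/|\Phi_p|$. \begin{enumerate} \item $\Sigma_\Pi(\mathbf h)=0$ if $\Pi_p$ (a) is trivial, or (b) contains an element of order $p^2$, or (c) intersects $[\Pi,\Pi]$ nontrivially. The case (c) includes the cases when $\Pi_p$ (d) is not abelian, or (e) does not map isomorphically onto $\Phi_p$ via the restriction of $\pi$, or (f) has size strictly greater than $|\Phi_p|$. \item Otherwise $\Pi_p\cong\Phi_p\cong(\mathbb Z/p\mathbb Z)^k$ for some $k>0$, and then $$\Sigma_\Pi(\mathbf h)=|[\Pi,\Pi]|\cdot\Sigma_{\Phi'}(\mathbf g)\cdot\Sigma_{\Pi_p}(\mathbf h).$$ \end{enumerate}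
   Context: A weight of $H$ is an $R$-algebra homomorphism $H\to R$. The set $\Gamma_H$ of weights is a group under convolution $(\lambda*\nu)(h)=(\lambda\otimes\nu)(\Delta(h))$, with identity the counit $\varepsilon$ and inverse $\lambda^{-1}=\lambda\circ S$. For a finite set $\Theta$ of weights, $\Sigma_\Theta:=\sum_{\gamma\in\Theta}\gamma:H\to R$. $G(H)$ is the group of grouplike elements ($\Delta(g)=g\otimes g$, $\varepsilon(g)=1$). An element $h\in H$ is pseudo-primitive with respect to $\Pi$ if $\Delta(h)=g\otimes h+h\otimes g'$ for some $g,g'\in G(H)$ with $\gamma(g^{-1}g')=1$ for all $\gamma\in\Pi$. Integers are viewed in $R$ via $\mathbb Z\to R$. $\Sigma_{\Phi'}(\mathbf g)$ denotes $\sum_{\tilde\gamma}\tilde\gamma(\mathbf g)$, where $\tilde\gamma$ runs over any set in $\Pi$ containing exactly one lift of each element of $\Phi'$; this does not depend on the choice of lifts. *)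

(* Defs.v *)
From HB Require Import structures.
From mathcomp Require Import all_boot all_algebra all_fingroup all_solvable.
From mathcomp Require Import finmap ring.
From mathcomp Require Import boolp generic_quotient.

Set Implicit Arguments.
Unset Strict Implicit.
Unset Printing Implicit Defensive.

Import GRing.Theory.
Local Open Scope ring_scope.

Section TensorEq.
Variables (R : comNzRingType) (M N : lmodType R).

(* A list [:: (x1, y1); ...; (xk, yk)] stands for the sum of the xi (x) yi. *)
Inductive teq : seq (M * N) -> seq (M * N) -> Prop :=
| teq_refl s : teq s s
| teq_sym s t : teq s t -> teq t s
| teq_trans s t u : teq s t -> teq t u -> teq s u
| teq_cat s s' t t' : teq s s' -> teq t t' -> teq (s ++ t) (s' ++ t')
| teq_catC s t : teq (s ++ t) (t ++ s)
| teq_0l y : teq [:: (0, y)] [::]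
| teq_Dl x x' y : teq [:: (x + x', y)] [:: (x, y); (x', y)]
| teq_Dr x y y' : teq [:: (x, y + y')] [:: (x, y); (x, y')]
| teq_Z a x y : teq [:: (a *: x, y)] [:: (x, a *: y)].

Definition teqb (s t : seq (M * N)) : bool := `[< teq s t >].

Fact teqb_refl : reflexive teqb.
Proof. by move=> s; apply/asboolP/teq_refl. Qed.
Fact teqb_sym : symmetric teqb.
Proof. by move=> s t; apply/asboolP/asboolP => /teq_sym. Qed.
Fact teqb_trans : transitive teqb.
Proof.
move=> t s u /asboolP st /asboolP tu; apply/asboolP; exact: teq_trans tu.
Qed.

Canonical teqb_equiv := EquivRel teqb teqb_refl teqb_sym teqb_trans.

Definition tensor : Type := {eq_quot teqb_equiv}%qT.
HB.instance Definition _ := Choice.on tensor.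
HB.instance Definition _ := Quotient.on tensor.

Definition tens_of (s : seq (M * N)) : tensor := \pi_tensor%qT s.
Definition tpure (x : M) (y : N) : tensor := tens_of [:: (x, y)].

Lemma tens_ofP s t : reflect (tens_of s = tens_of t) `[< teq s t >].
Proof. exact: (@eqmodP _ teqb_equiv). Qed.

Lemma tens_of_eq s t : teq s t -> tens_of s = tens_of t.
Proof. by move=> st; apply/tens_ofP/asboolP. Qed.

Lemma tens_of_repr (t : tensor) : tens_of (repr t) = t.
Proof. exact: reprK. Qed.

Lemma teq_repr s : teq (repr (tens_of s)) s.
Proof. by apply/asboolP/tens_ofP; rewrite tens_of_repr. Qed.

Definition tens_add (t u : tensor) : tensor := tens_of (repr t ++ repr u).
Definition tens_scale (a : R) (t : tensor) : tensor :=
  tens_of [seq (a *: xy.1, xy.2) | xy <- repr t].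
Definition tens_zero : tensor := tens_of [::].
Definition tens_opp (t : tensor) := tens_scale (-1) t.

Lemma tens_addE s t : tens_add (tens_of s) (tens_of t) = tens_of (s ++ t).
Proof. by apply/tens_of_eq/teq_cat; apply: teq_repr. Qed.

Lemma teq_scale a s t : teq s t ->
  teq [seq (a *: xy.1, xy.2) | xy <- s] [seq (a *: xy.1, xy.2) | xy <- t].
Proof.
elim=> {s t} /=.
- by move=> s; apply: teq_refl.
- by move=> s t _ /teq_sym.
- by move=> s t u _ st _; apply: teq_trans.
- by move=> s s' t t' _ ? _ ?; rewrite !map_cat; apply: teq_cat.
- by move=> s t; rewrite !map_cat; apply: teq_catC.
- by move=> y; rewrite scaler0; apply: teq_0l.
- by move=> x x' y; rewrite scalerDr; apply: teq_Dl.
- by move=> x y y'; apply: teq_Dr.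
- by move=> b x y; rewrite scalerA mulrC -scalerA; apply: teq_Z.
Qed.

Lemma tens_scaleE a s :
  tens_scale a (tens_of s) = tens_of [seq (a *: xy.1, xy.2) | xy <- s].
Proof. by apply/tens_of_eq/teq_scale/teq_repr. Qed.

Lemma tens_elimP (P : tensor -> Prop) : (forall s, P (tens_of s)) ->
  forall t, P t.
Proof. by move=> Ps t; rewrite -(tens_of_repr t). Qed.

Fact tens_addA : associative tens_add.
Proof.
elim/tens_elimP=> s; elim/tens_elimP=> t; elim/tens_elimP=> u.
by rewrite !tens_addE catA.
Qed.
Fact tens_addC : commutative tens_add.
Proof.
elim/tens_elimP=> s; elim/tens_elimP=> t.
by rewrite !tens_addE; apply/tens_of_eq/teq_catC.
Qed.
Fact tens_add0 : left_id tens_zero tens_add.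
Proof. by elim/tens_elimP=> s; rewrite tens_addE. Qed.

Lemma teq_shuffle c d (s t : seq (M * N)) :
  teq ((c :: s) ++ (d :: t)) ([:: c; d] ++ (s ++ t)).
Proof.
rewrite -[c :: s]cat1s -[d :: t]cat1s -[[:: c; d]]/([:: c] ++ [:: d]).
rewrite -!catA; apply: teq_cat (teq_refl _) _.
by rewrite !catA; apply: teq_cat (teq_catC _ _) (teq_refl _).
Qed.

Fact tens_addN : left_inverse tens_zero tens_opp tens_add.
Proof.
elim/tens_elimP=> s; rewrite /tens_opp tens_scaleE tens_addE.
apply: tens_of_eq; elim: s => [|[x y] s IHs]; first exact: teq_refl.
apply: teq_trans (teq_shuffle _ _ _ _) _.
rewrite -[X in teq _ X]cat0s; apply: teq_cat IHs.
apply: teq_trans (teq_sym (teq_Dl _ _ _)) _.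
by rewrite scaleN1r addNr; apply: teq_0l.
Qed.

HB.instance Definition _ :=
  GRing.isZmodule.Build tensor tens_addA tens_addC tens_add0 tens_addN.

Fact tens_scaleA a b (t : tensor) :
  tens_scale a (tens_scale b t) = tens_scale (a * b) t.
Proof.
elim/tens_elimP: t => s; rewrite !tens_scaleE -map_comp; congr tens_of.
by apply: eq_map => -[x y] /=; rewrite scalerA.
Qed.
Fact tens_scale1 : left_id 1 tens_scale.
Proof.
elim/tens_elimP=> s; rewrite tens_scaleE; congr tens_of.
by rewrite -[RHS]map_id; apply: eq_map => -[x y] /=; rewrite scale1r.
Qed.
Fact tens_scaleDr : right_distributive tens_scale (+%R : tensor -> _).
Proof.
move=> a; elim/tens_elimP=> s; elim/tens_elimP=> t.
by rewrite [_ + _]tens_addE !tens_scaleE [RHS]tens_addE map_cat.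
Qed.
Fact tens_scaleDl (t : tensor) : {morph tens_scale^~ t : a b / a + b}.
Proof.
elim/tens_elimP: t => s a b; rewrite !tens_scaleE [RHS]tens_addE.
apply: tens_of_eq; elim: s => [|[x y] s IHs]; first exact: teq_refl.
apply: teq_sym; apply: teq_trans (teq_shuffle _ _ _ _) _.
apply: (@teq_cat [:: _; _] [:: _]) (teq_sym IHs).
by rewrite /= scalerDl; apply/teq_sym/teq_Dl.
Qed.

HB.instance Definition _ := GRing.Zmodule_isLmodule.Build R tensor
  tens_scaleA tens_scale1 tens_scaleDr tens_scaleDl.

Lemma tens_of_cons x y s : tens_of ((x, y) :: s) = tpure x y + tens_of s.
Proof. by rewrite [RHS]tens_addE. Qed.

Lemma tens_ofE s : tens_of s = \sum_(xy <- s) tpure xy.1 xy.2.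
Proof.
elim: s => [|[x y] s IHs]; first by rewrite big_nil.
by rewrite big_cons tens_of_cons IHs.
Qed.

Lemma tens_ind (P : tensor -> Prop) : P 0 ->
  (forall x y t, P t -> P (tpure x y + t)) -> forall t, P t.
Proof.
move=> P0 PD; elim/tens_elimP; elim=> [|[x y] s IHs]; first exact: P0.
by rewrite tens_of_cons; apply: PD.
Qed.

Fact tpure_bilinear : bilinear_for *:%R *:%R tpure.
Proof.
split=> [y|x] a u v.
  rewrite /tpure /= [X in _ = X + _]tens_scaleE [RHS]tens_addE /=.
  exact/tens_of_eq/teq_Dl.
rewrite /tpure /= [X in _ = X + _]tens_scaleE [RHS]tens_addE /=.
apply: tens_of_eq; apply: teq_trans (teq_Dr _ _ _) _.
apply: (@teq_cat [:: _] [:: _]); last exact: teq_refl.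
exact/teq_sym/teq_Z.
Qed.

Lemma tens_ext (V : zmodType) (f g : tensor -> V) :
  {morph f : t u / t + u} -> {morph g : t u / t + u} ->
  (forall x y, f (tpure x y) = g (tpure x y)) -> f =1 g.
Proof.
move=> fD gD fg t.
have f0: f 0 = 0 by apply: (addrI (f 0)); rewrite -fD !addr0.
have g0: g 0 = 0 by apply: (addrI (g 0)); rewrite -gD !addr0.
elim/tens_ind: t => [|x y t IHt]; first by rewrite f0 g0.
by rewrite fD gD fg IHt.
Qed.

(* The linear map on the tensor product induced by f; meaningful (by tliftE *)
(* and tlift_linear) only when f is bilinear.                               *)
Definition tlift (V : zmodType) (f : M -> N -> V) (t : tensor) : V :=
  \sum_(xy <- repr t) f xy.1 xy.2.

Section Lift.
Variables (V : zmodType) (s : GRing.Scale.law R V) (f : M -> N -> V).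
Hypothesis fB : bilinear_for s s f.

Lemma bilin_Dl x x' y : f (x + x') y = f x y + f x' y.
Proof. exact: (GRing.semilinear_linear (fB.1 y)).2. Qed.
Lemma bilin_Dr x y y' : f x (y + y') = f x y + f x y'.
Proof. exact: (GRing.semilinear_linear (fB.2 x)).2. Qed.
Lemma bilin_Zl a x y : f (a *: x) y = s a (f x y).
Proof. exact: (GRing.semilinear_linear (fB.1 y)).1. Qed.
Lemma bilin_Zr a x y : f x (a *: y) = s a (f x y).
Proof. exact: (GRing.semilinear_linear (fB.2 x)).1. Qed.
Lemma bilin_0l y : f 0 y = 0.
Proof. by apply: (addrI (f 0 y)); rewrite -bilin_Dl !addr0. Qed.
Lemma bilin_0r x : f x 0 = 0.
Proof. by apply: (addrI (f x 0)); rewrite -bilin_Dr !addr0. Qed.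

Lemma tlift_of l : tlift f (tens_of l) = \sum_(xy <- l) f xy.1 xy.2.
Proof.
have teq_sum k k' : teq k k' ->
    \sum_(xy <- k) f xy.1 xy.2 = \sum_(xy <- k') f xy.1 xy.2; last first.
  exact/teq_sum/teq_repr.
elim=> //=.
- by move=> ? ? ? _ -> _ ->.
- by move=> ? ? ? ? _ e1 _ e2; rewrite !big_cat /= e1 e2.
- by move=> ? ?; rewrite !big_cat /= addrC.
- by move=> y; rewrite big_seq1 big_nil /= bilin_0l.
- by move=> *; rewrite big_seq1 big_cons big_seq1 /= bilin_Dl.
- by move=> *; rewrite big_seq1 big_cons big_seq1 /= bilin_Dr.
- by move=> *; rewrite !big_seq1 /= bilin_Zl bilin_Zr.
Qed.

Lemma tliftE x y : tlift f (tpure x y) = f x y.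
Proof. by rewrite tlift_of big_seq1. Qed.

Lemma tlift_D : {morph tlift f : t u / t + u}.
Proof.
elim/tens_elimP=> l; elim/tens_elimP=> l'.
by rewrite [_ + _ in LHS]tens_addE !tlift_of big_cat.
Qed.

Lemma tlift_linear : linear_for s (tlift f).
Proof.
move=> a t u; have [op0 opD] := GRing.Scale.op_nmod_morphism (s := s) a.
rewrite tlift_D; congr (_ + _).
elim/tens_elimP: t => l; rewrite [_ *: _]tens_scaleE !tlift_of big_map /=.
rewrite (big_morph (s a) opD op0).
by apply: eq_bigr => -[x y] _; rewrite /= bilin_Zl.
Qed.

End Lift.

End TensorEq.

Arguments tensor {R} (M N)%_type_scope.

Notation "x '⊗' y" := (tpure x y) (at level 40, left associativity) : ring_scope.
Notation "M '⊗' N" := (tensor M N) : type_scope.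

Section TensorTheory.
Variables (R : comNzRingType) (M N : lmodType R).
Implicit Types (t u : M ⊗ N).

Lemma tpure_linl a (x x' : M) (y : N) :
  (a *: x + x') ⊗ y = a *: (x ⊗ y) + x' ⊗ y.
Proof. exact: (tpure_bilinear M N).1. Qed.

Lemma tpure_linr a (x : M) (y y' : N) :
  x ⊗ (a *: y + y') = a *: (x ⊗ y) + x ⊗ y'.
Proof. exact: (tpure_bilinear M N).2. Qed.

Lemma tlift_funP (V : zmodType) (s : GRing.Scale.law R V) a
    (f g h : M -> N -> V) t :
  (forall x y, h x y = s a (f x y) + g x y) ->
  tlift h t = s a (tlift f t) + tlift g t.
Proof.
move=> hE; have [op0 opD] := GRing.Scale.op_nmod_morphism (s := s) a.
rewrite /tlift (big_morph (s a) opD op0) -big_split.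
by apply: eq_bigr => xy _; apply: hE.
Qed.

Lemma eq_tlift (V : zmodType) (f g : M -> N -> V) t :
  (forall x y, f x y = g x y) -> tlift f t = tlift g t.
Proof. by move=> fg; apply: eq_bigr => xy _; apply: fg. Qed.

Lemma tensE t : t = \sum_(xy <- repr t) xy.1 ⊗ xy.2.
Proof. by rewrite -tens_ofE tens_of_repr. Qed.

End TensorTheory.

Section TensorMap.
Variable R : comNzRingType.

Definition tmap (M N M' N' : lmodType R) (f : M -> M') (g : N -> N') :
  M ⊗ N -> M' ⊗ N' := tlift (fun x y => f x ⊗ g y).

Definition tassoc (L M N : lmodType R) : (L ⊗ M) ⊗ N -> L ⊗ (M ⊗ N) :=
  tlift (fun t z => tlift (fun x y => x ⊗ (y ⊗ z)) t).

Lemma tmap_bilinear (M N M' N' : lmodType R) (f : M -> M') (g : N -> N') :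
  linear f -> linear g ->
  bilinear_for *:%R *:%R (fun x y => f x ⊗ g y : M' ⊗ N').
Proof.
move=> fL gL; split=> [y|x] a u v; first by rewrite /= fL tpure_linl.
by rewrite /= gL tpure_linr.
Qed.

Lemma tassoc_bilinear1 (L M N : lmodType R) (z : N) :
  bilinear_for *:%R *:%R (fun x y => x ⊗ (y ⊗ z) : L ⊗ (M ⊗ N)).
Proof.
split=> [y|x] a u v; first by rewrite /= tpure_linl.
by rewrite /= tpure_linl tpure_linr.
Qed.

Lemma tassoc_bilinear (L M N : lmodType R) :
  bilinear_for *:%R *:%R
    (fun t z => tlift (fun x y => x ⊗ (y ⊗ z)) t : L ⊗ (M ⊗ N)).
Proof.
split=> [z|t] a u v; first exact/tlift_linear/tassoc_bilinear1.
by apply: tlift_funP => x y; rewrite !tpure_linr.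
Qed.

Lemma tassocE (L M N : lmodType R) (x : L) (y : M) (z : N) :
  tassoc ((x ⊗ y) ⊗ z) = x ⊗ (y ⊗ z).
Proof.
rewrite /tassoc (tliftE (@tassoc_bilinear L M N)).
by rewrite (tliftE (@tassoc_bilinear1 L M N z)).
Qed.

End TensorMap.

Section TensorAlgebra.
Variables (R : comNzRingType) (A B : algType R).
Implicit Types (t u v : A ⊗ B).

Definition tens_mul t u : A ⊗ B :=
  tlift (fun a b => tlift (fun c d => (a * c) ⊗ (b * d)) u) t.
Definition tens_one : A ⊗ B := 1 ⊗ 1.

Fact tens_mul_bilinear1 (a : A) (b : B) :
  bilinear_for *:%R *:%R (fun c d => (a * c) ⊗ (b * d) : A ⊗ B).
Proof.
split=> [d|c] k x y; first by rewrite /= mulrDr -scalerAr tpure_linl.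
by rewrite /= mulrDr -scalerAr tpure_linr.
Qed.

Fact tens_mul_bilinear2 u :
  bilinear_for *:%R *:%R
    (fun a b => tlift (fun c d => (a * c) ⊗ (b * d)) u : A ⊗ B).
Proof.
split=> [b|a] k x y; apply: tlift_funP => c d.
  by rewrite mulrDl -scalerAl tpure_linl.
by rewrite mulrDl -scalerAl tpure_linr.
Qed.

Lemma tens_mul_bilinear : bilinear_for *:%R *:%R tens_mul.
Proof.
split=> [u|t] k x y; first exact/tlift_linear/tens_mul_bilinear2.
by apply: tlift_funP => a b; apply/tlift_linear/tens_mul_bilinear1.
Qed.

Lemma tens_mulE (a c : A) (b d : B) :
  tens_mul (a ⊗ b) (c ⊗ d) = (a * c) ⊗ (b * d).
Proof.
rewrite /tens_mul (tliftE (tens_mul_bilinear2 _)).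
by rewrite (tliftE (tens_mul_bilinear1 _ _)).
Qed.

Fact tens_mulDl : left_distributive tens_mul +%R.
Proof. by move=> t u v; apply: (bilin_Dl tens_mul_bilinear). Qed.
Fact tens_mulDr : right_distributive tens_mul +%R.
Proof. by move=> t u v; apply: (bilin_Dr tens_mul_bilinear). Qed.
Fact tens_mul0t t : tens_mul 0 t = 0.
Proof. exact: (bilin_0l tens_mul_bilinear). Qed.
Fact tens_mult0 t : tens_mul t 0 = 0.
Proof. exact: (bilin_0r tens_mul_bilinear). Qed.

Fact tens_mulA : associative tens_mul.
Proof.
elim/tens_ind=> [|a b t IHt] u v; first by rewrite !tens_mul0t.
rewrite !tens_mulDl IHt; congr (_ + _); elim/tens_ind: u v => [|c d u IHu] v.
  by rewrite tens_mul0t tens_mult0 tens_mul0t.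
rewrite !(tens_mulDl, tens_mulDr) IHu; congr (_ + _).
elim/tens_ind: v => [|e f v IHv]; first by rewrite !tens_mult0.
by rewrite !tens_mulDr IHv !tens_mulE !mulrA.
Qed.
Fact tens_mul1t : left_id tens_one tens_mul.
Proof.
elim/tens_ind=> [|a b t IHt]; first exact: tens_mult0.
by rewrite tens_mulDr IHt tens_mulE !mul1r.
Qed.
Fact tens_mult1 : right_id tens_one tens_mul.
Proof.
elim/tens_ind=> [|a b t IHt]; first exact: tens_mul0t.
by rewrite tens_mulDl IHt tens_mulE !mulr1.
Qed.

HB.instance Definition _ := GRing.Zmodule_isPzRing.Build (tensor A B)
  tens_mulA tens_mul1t tens_mult1 tens_mulDl tens_mulDr.

Lemma tpureM (a c : A) (b d : B) :
  (a ⊗ b) * (c ⊗ d) = (a * c) ⊗ (b * d) :> A ⊗ B.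
Proof. exact: tens_mulE. Qed.

Lemma tpure1 : 1 ⊗ 1 = 1 :> A ⊗ B.
Proof. by []. Qed.

End TensorAlgebra.

HB.mixin Record isHopfAlgebra (R : comNzRingType) H of GRing.Algebra R H := {
  comul : {lrmorphism H -> H ⊗ H};
  counit : {lrmorphism H -> R | *%R};
  antipode : {linear H -> H};
  comulA : forall h : H,
    tassoc (tmap comul idfun (comul h)) = tmap idfun comul (comul h);
  counitl : forall h : H, tlift (fun x y => counit x *: y) (comul h) = h;
  counitr : forall h : H, tlift (fun x y => counit y *: x) (comul h) = h;
  antipodel : forall h : H,
    tlift (fun x y => antipode x * y) (comul h) = (counit h)%:A;
  antipoder : forall h : H,
    tlift (fun x y => x * antipode y) (comul h) = (counit h)%:A
}.

#[short(type="hopfAlgType")]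
HB.structure Definition HopfAlgebra (R : comNzRingType) :=
  {H of GRing.Algebra R H & isHopfAlgebra R H}.

Section TensorLift.
Variables (R : comNzRingType) (V : zmodType) (s : GRing.Scale.law R V).

Lemma tlift_tlift (M N M' N' : lmodType R) (G : M' -> N' -> V)
    (K : M -> N -> M' ⊗ N') t :
  bilinear_for s s G ->
  tlift G (tlift K t) = tlift (fun x y => tlift G (K x y)) t.
Proof.
move=> GB; have G0 : tlift G 0 = 0.
  by rewrite -[0 in LHS]/(@tens_of _ M' N' [::]) (tlift_of GB) big_nil.
by rewrite {2}/tlift (big_morph _ (tlift_D GB) G0).
Qed.

Lemma tlift_mul (A B : algType R) (G : A -> B -> V) (t u : A ⊗ B) :
  bilinear_for s s G ->
  tlift G (t * u) =
    tlift (fun a b => tlift (fun c d => G (a * c) (b * d)) u) t.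
Proof.
move=> GB; rewrite [t * u]/(tens_mul t u) /tens_mul (tlift_tlift _ _ GB).
apply: eq_tlift => a b; rewrite (tlift_tlift _ _ GB).
by apply: eq_tlift => c d; rewrite (tliftE GB).
Qed.

Lemma tlift_exchange (M N M' N' : lmodType R) (f : M -> N -> M' -> N' -> V)
    t u :
  tlift (fun a b => tlift (fun c d => f a b c d) u) t =
  tlift (fun c d => tlift (fun a b => f a b c d) t) u.
Proof. exact: exchange_big. Qed.

End TensorLift.

Section HopfTheory.
Variables (R : comNzRingType) (H : hopfAlgType R).
Implicit Types (a b h : H).

Lemma comulAE h :
  tassoc (tlift (fun x y => (comul x : H ⊗ H) ⊗ y) (comul h)) =
  tlift (fun x y => x ⊗ (comul y : H ⊗ H)) (comul h).
Proof. exact: comulA. Qed.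

Section Coassoc.
Variables (V : zmodType) (s : GRing.Scale.law R V) (f : H -> H -> H -> V).
Hypothesis f1 : forall k a a' b c, f (k *: a + a') b c = s k (f a b c) + f a' b c.
Hypothesis f2 : forall k a b b' c, f a (k *: b + b') c = s k (f a b c) + f a b' c.
Hypothesis f3 : forall k a b c c', f a b (k *: c + c') = s k (f a b c) + f a b c'.

Lemma tlift_comulA h :
  tlift (fun x c => tlift (fun a b => f a b c) (comul x)) (comul h) =
  tlift (fun a y => tlift (fun b c => f a b c) (comul y)) (comul h).
Proof.
have f23 a : bilinear_for s s (f a) by split=> [y|x] k u v /=; rewrite ?f2 ?f3.
have f12 c : bilinear_for s s (fun a b => f a b c).
  by split=> [y|x] k u v /=; rewrite ?f1 ?f2.
have FB : bilinear_for s s (fun a t => tlift (f a) t).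
  split=> [t|a] k u v /=; last exact: tlift_linear.
  by apply: tlift_funP => b c; rewrite f1.
have mB : bilinear_for *:%R *:%R (fun x y => (x : H) ⊗ comul y : H ⊗ (H ⊗ H)).
  by apply: (@tmap_bilinear _ _ _ _ _ idfun); [move=> k u v|exact: linearP].
have GB : bilinear_for s s (fun t c => tlift (fun a b => f a b c) t).
  split=> [c|t] k u v /=; first exact/tlift_linear.
  by apply: tlift_funP => a b; rewrite f3.
set F := fun a t => tlift (f a) t.
have E : tlift F (tassoc (tlift (fun x y => (comul x : H ⊗ H) ⊗ y) (comul h)))
    = tlift F (tlift (fun x y => x ⊗ (comul y : H ⊗ H)) (comul h)).
  by rewrite comulAE.
transitivity (tlift F
    (tassoc (tlift (fun x y => (comul x : H ⊗ H) ⊗ y) (comul h)))).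
  rewrite /tassoc (tlift_tlift _ _ FB).
  have KB : bilinear_for s s (fun (t : H ⊗ H) (c : H) =>
     tlift (fun a t => tlift (f a) t)
       (tlift (fun x y => x ⊗ (y ⊗ c) : H ⊗ (H ⊗ H)) t)).
    split=> [c|t] k u v /=.
      rewrite (tlift_linear (@tassoc_bilinear1 R H H H c)).
      exact: tlift_linear.
    rewrite -(tlift_linear FB); congr tlift.
    by apply: tlift_funP => x y; rewrite !tpure_linr.
  rewrite (tlift_tlift _ _ KB); apply: eq_tlift => x c.
  rewrite (tliftE KB) (tlift_tlift _ _ FB); apply: eq_tlift => a b.
  by rewrite (tliftE FB) (tliftE (f23 a)).
by rewrite E (tlift_tlift _ _ FB); apply: eq_tlift => a y; exact: (tliftE FB).
Qed.

End Coassoc.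

Lemma mul_bilinear (A : algType R) (f g : H -> A) : linear f -> linear g ->
  bilinear_for *:%R *:%R (fun x y => f x * g y).
Proof.
move=> fL gL; split=> [y|x] k u v /=; first by rewrite fL mulrDl -scalerAl.
by rewrite gL mulrDr -scalerAr.
Qed.

Lemma scalar_bilinear (f g : H -> R) : scalar f -> scalar g ->
  bilinear_for *%R *%R (fun x y => f x * g y).
Proof.
move=> fL gL; split=> [y|x] k u v /=; first by rewrite fL mulrDl -mulrA.
by rewrite gL mulrDr mulrCA.
Qed.

End HopfTheory.

Section Weights.
Variables (R : comNzRingType) (H : hopfAlgType R).

Definition weight : Type := {lrmorphism H -> R | *%R}.
HB.instance Definition _ := gen_eqMixin weight.
HB.instance Definition _ := gen_choiceMixin weight.
Implicit Types (l m n : weight) (a b h : H).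

Lemma weight_ext l m : l =1 m -> l = m.
Proof.
case: l => f cf; case: m => g cg /= /funext fg.
case: _ / fg in cg *; congr GRing.LRMorphism.Pack.
case: cf cg => [[a1] [a2] [a3]] [[b1] [b2] [b3]].
by rewrite (Prop_irrelevance a1 b1) (Prop_irrelevance a2 b2)
  (Prop_irrelevance a3 b3).
Qed.

(* Convolution (f (x) g) o comul, after identifying R (x) R with R. *)
Definition conv (f g : H -> R) h : R :=
  tlift (fun x y => f x * g y) (comul h).
Definition conv_inv (f : H -> R) h : R := f (antipode h).

Lemma weight_scalar l : scalar l.
Proof. by move=> k u v; rewrite linearP. Qed.
Lemma antipode_scalar l : scalar (conv_inv l).
Proof. by move=> k u v; rewrite /conv_inv !linearP. Qed.

Fact conv_scalar l m : scalar (conv l m).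
Proof.
move=> k u v; rewrite /conv linearP.
exact/tlift_linear/scalar_bilinear/weight_scalar/weight_scalar.
Qed.
Fact conv_monoid l m : GRing.monoid_morphism (conv l m).
Proof.
have B := scalar_bilinear (weight_scalar l) (weight_scalar m).
split=> [|a b]; rewrite /conv ?rmorph1 ?rmorphM.
  by rewrite (tliftE B) !rmorph1 mulr1.
rewrite (tlift_mul _ _ B) /tlift big_distrl /=; apply: eq_bigr => x _.
rewrite big_distrr /=; apply: eq_bigr => y _.
by rewrite !rmorphM mulrACA.
Qed.

HB.instance Definition _ l m :=
  GRing.isLinear.Build R H R *%R (conv l m) (conv_scalar l m).
HB.instance Definition _ l m :=
  GRing.isMonoidMorphism.Build H R (conv l m) (conv_monoid l m).

Lemma weight_alg l (k : R) : l k%:A = k.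
Proof. by rewrite linearZ /= rmorph1 mulr1. Qed.

Lemma antipode1 : antipode 1 = 1 :> H.
Proof.
have B : bilinear_for *:%R *:%R (fun x y : H => antipode x * y).
  by apply: (@mul_bilinear _ _ _ _ idfun); [exact: linearP|move=> ? ? ?].
have := antipodel (1 : H).
by rewrite !rmorph1 scale1r -(@tpure1 R H H) (tliftE B) mulr1.
Qed.

Lemma weight_tlift l (f : H -> H -> H) (t : H ⊗ H) :
  l (tlift f t) = tlift (fun x y => l (f x y)) t.
Proof. exact: raddf_sum. Qed.

Fact conv_invl l h : conv (conv_inv l) l h = counit h.
Proof.
rewrite -[RHS](weight_alg l) -antipodel weight_tlift.
by apply: eq_tlift => x y; rewrite rmorphM.
Qed.
Fact conv_invr l h : conv l (conv_inv l) h = counit h.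
Proof.
rewrite -[RHS](weight_alg l) -antipoder weight_tlift.
by apply: eq_tlift => x y; rewrite rmorphM.
Qed.

Fact conv_counitl (f : H -> R) h : scalar f -> conv counit f h = f h.
Proof.
move=> fL; have [fZ fD] := GRing.semilinear_linear fL.
have f0 : f 0 = 0 by apply: (addrI (f 0)); rewrite -fD !addr0.
rewrite -[in RHS](counitl h) /tlift (big_morph f fD f0).
by apply: eq_bigr => x _; rewrite fZ.
Qed.
Fact conv_counitr (f : H -> R) h : scalar f -> conv f counit h = f h.
Proof.
move=> fL; have [fZ fD] := GRing.semilinear_linear fL.
have f0 : f 0 = 0 by apply: (addrI (f 0)); rewrite -fD !addr0.
rewrite -[in RHS](counitr h) /tlift (big_morph f fD f0).
by apply: eq_bigr => x _; rewrite fZ mulrC.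
Qed.

Fact conv_assoc (f g e : H -> R) h : scalar f -> scalar g -> scalar e ->
  conv f (conv g e) h = conv (conv f g) e h.
Proof.
move=> fL gL eL; rewrite /conv.
transitivity (tlift (fun a y => tlift (fun b c => f a * g b * e c) (comul y))
   (comul h)).
  apply: eq_tlift => a y; rewrite /tlift big_distrr /=.
  by apply: eq_bigr => x _; rewrite mulrA.
rewrite -(@tlift_comulA _ _ _ *%R).
- apply: eq_tlift => x c; rewrite /tlift big_distrl /=.
  by apply: eq_bigr.
- by move=> k a a' b c; rewrite fL !mulrDl -!mulrA.
- by move=> k a b b' c; rewrite gL mulrDr mulrDl mulrCA -!mulrA.
- by move=> k a b c c'; rewrite eL mulrDr mulrCA.
Qed.

Fact conv_invM l a b : conv_inv l (a * b) = conv_inv l a * conv_inv l b.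
Proof.
set m := conv_inv l; have mL : scalar m by apply: antipode_scalar.
have lL : scalar l by apply: weight_scalar.
have eL : scalar (counit : H -> R) by move=> k u v; rewrite linearP.
pose X := tlift (fun x y => tlift (fun y1 y2 =>
   tlift (fun z w => tlift (fun w1 w2 =>
     m (x * z) * (l y1 * m y2) * (l w1 * m w2)) (comul w)) (comul b))
   (comul y)) (comul a).
have mlin k u v c : m ((k *: u + v) * c) = k * m (u * c) + m (v * c).
  by rewrite mulrDl -scalerAl mL.
have mlinr k u v c : m (c * (k *: u + v)) = k * m (c * u) + m (c * v).
  by rewrite mulrDr -scalerAr mL.
transitivity X.
  have lm y : tlift (fun y1 y2 => l y1 * m y2) (comul y) = counit y.
    exact: conv_invr.
  transitivity (tlift (fun x y =>
     tlift (fun z w => m (x * z) * counit y * counit w) (comul b)) (comul a)).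
    rewrite -(@conv_counitr (fun x => m (x * b)) a); last first.
      by move=> k u v; apply: mlin.
    apply: eq_tlift => x y; rewrite -(@conv_counitr (fun z => m (x * z)) b).
      rewrite /conv /tlift big_distrl /=; apply: eq_bigr => z _; ring.
    by move=> k u v; apply: mlinr.
  apply: eq_tlift => x y; rewrite tlift_exchange.
  apply: eq_tlift => z w; rewrite -(lm y) /tlift big_distrr big_distrl /=.
  by apply: eq_bigr => u _; rewrite -(lm w) /tlift big_distrr.
pose f x y1 y2 := tlift (fun z w => tlift (fun w1 w2 =>
     m (x * z) * (l y1 * m y2) * (l w1 * m w2)) (comul w)) (comul b).
transitivity (tlift (fun x c => tlift (fun a b => f a b c) (comul x)) (comul a)).
  rewrite /X -(@tlift_comulA _ _ _ *%R) //.
  - move=> k u v y1 y2; apply: tlift_funP => z w; apply: tlift_funP => w1 w2 /=.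
    by rewrite mlin; ring.
  - move=> k x u v y2; apply: tlift_funP => z w; apply: tlift_funP => w1 w2 /=.
    by rewrite lL; ring.
  - move=> k x y1 u v; apply: tlift_funP => z w; apply: tlift_funP => w1 w2 /=.
    by rewrite mL; ring.
have ml x z : tlift (fun a1 a2 => tlift (fun b1 b2 =>
     m (a1 * b1) * l (a2 * b2)) (comul z)) (comul x) = counit x * counit z.
  have <- : conv m l (x * z) = counit x * counit z by rewrite conv_invl rmorphM.
  rewrite /conv rmorphM.
  by rewrite (tlift_mul _ _ (scalar_bilinear mL lL)).
transitivity (tlift (fun x c => tlift (fun z d =>
   counit x * counit z * (m c * m d)) (comul b)) (comul a)).
  apply: eq_tlift => x c; rewrite /f.
  transitivity (tlift (fun a1 a2 => tlift (fun z d => tlift (fun b1 b2 =>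
     m (a1 * b1) * (l a2 * m c) * (l b2 * m d)) (comul z)) (comul b)) (comul x)).
    apply: eq_tlift => a1 a2; rewrite -(@tlift_comulA _ _ _ *%R) //.
    + by move=> k u v y1 y2; rewrite /= mlinr; ring.
    + by move=> k u v y1 y2; rewrite /= lL; ring.
    + by move=> k u v y1 y2; rewrite /= mL; ring.
  rewrite tlift_exchange; apply: eq_tlift => z d; rewrite -ml /tlift.
  rewrite big_distrl /=; apply: eq_bigr => u _; rewrite big_distrl /=.
  by apply: eq_bigr => v _; rewrite rmorphM; ring.
have em c : m c = tlift (fun x y => counit x * m y) (comul c).
  by rewrite -(conv_counitl c mL).
rewrite (em a) (em b) /tlift big_distrl /=; apply: eq_bigr => x _.
by rewrite big_distrr /=; apply: eq_bigr => y _; rewrite mulrACA.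
Qed.

Fact conv_inv_monoid l : GRing.monoid_morphism (conv_inv l).
Proof.
by split=> [|a b]; [rewrite /conv_inv antipode1 rmorph1|exact: conv_invM].
Qed.

HB.instance Definition _ l :=
  GRing.isLinear.Build R H R *%R (conv_inv l) (antipode_scalar l).
HB.instance Definition _ l :=
  GRing.isMonoidMorphism.Build H R (conv_inv l) (conv_inv_monoid l).

Definition weight_mul l m : weight := conv l m.
Definition weight_inv l : weight := conv_inv l.
Definition weight_one : weight := counit.

Fact weight_mulA : associative weight_mul.
Proof.
by move=> l m n; apply: weight_ext => h; apply: conv_assoc; apply: weight_scalar.
Qed.
Fact weight_mul1 : left_id weight_one weight_mul.
Proof.
by move=> l; apply: weight_ext => h; apply/conv_counitl/weight_scalar.
Qed.
Fact weight_1mul : right_id weight_one weight_mul.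
Proof.
by move=> l; apply: weight_ext => h; apply/conv_counitr/weight_scalar.
Qed.
Fact weight_mulV : left_inverse weight_one weight_inv weight_mul.
Proof. by move=> l; apply: weight_ext => h; apply: conv_invl. Qed.
Fact weight_mulVr : right_inverse weight_one weight_inv weight_mul.
Proof. by move=> l; apply: weight_ext => h; apply: conv_invr. Qed.

HB.instance Definition _ := isGroup.Build weight
  weight_mulA weight_mul1 weight_1mul weight_mulV weight_mulVr.

End Weights.

Section Grouplike.
Variables (R : comNzRingType) (H : hopfAlgType R).

Record grouplike : Type := Grouplike {
  gl_val : H;
  _ : `[< comul gl_val = gl_val ⊗ gl_val /\ counit gl_val = 1 >]
}.
HB.instance Definition _ := [isSub for gl_val].
HB.instance Definition _ := [Choice of grouplike by <:].
Implicit Types g : grouplike.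

Lemma comulM (x y : H) : comul (x * y) = comul x * comul y.
Proof. exact: rmorphM. Qed.
Lemma comul1 : comul 1 = 1 :> (H ⊗ H).
Proof. exact: rmorph1. Qed.
Lemma counitM (x y : H) : counit (x * y) = counit x * counit y.
Proof. exact: rmorphM. Qed.
Lemma counit1 : counit (1 : H) = 1.
Proof. exact: rmorph1. Qed.

Lemma comul_gl g : comul (gl_val g) = gl_val g ⊗ gl_val g.
Proof. by case: g => g /= /asboolP[]. Qed.
Lemma counit_gl g : counit (gl_val g) = 1.
Proof. by case: g => g /= /asboolP[]. Qed.

Lemma antipode_gll g : antipode (gl_val g) * gl_val g = 1.
Proof.
have B : bilinear_for *:%R *:%R (fun x y : H => antipode x * y).
  by apply: (@mul_bilinear _ _ _ _ idfun); [exact: linearP|move=> ? ? ?].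
have := antipodel (gl_val g).
by rewrite comul_gl counit_gl scale1r (tliftE B).
Qed.
Lemma antipode_glr g : gl_val g * antipode (gl_val g) = 1.
Proof.
have B : bilinear_for *:%R *:%R (fun x y : H => x * antipode y).
  by apply: (@mul_bilinear _ _ _ idfun); [move=> ? ? ?|exact: linearP].
have := antipoder (gl_val g).
by rewrite comul_gl counit_gl scale1r (tliftE B).
Qed.

Fact gl_mul_subproof g1 g2 :
  `[< comul (gl_val g1 * gl_val g2) = (gl_val g1 * gl_val g2) ⊗ (gl_val g1 * gl_val g2)
      /\ counit (gl_val g1 * gl_val g2) = 1 >].
Proof.
apply/asboolP; rewrite comulM counitM !comul_gl !counit_gl mulr1; split=> //.
exact: tpureM.
Qed.
Fact gl_one_subproof :
  `[< comul (1 : H) = (1 : H) ⊗ (1 : H) /\ counit (1 : H) = 1 >].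
Proof. by apply/asboolP; rewrite comul1 counit1. Qed.
Fact gl_inv_subproof g :
  `[< comul (antipode (gl_val g)) = antipode (gl_val g) ⊗ antipode (gl_val g)
      /\ counit (antipode (gl_val g)) = 1 >].
Proof.
apply/asboolP; split; last first.
  by rewrite -[LHS]mulr1 -{1}(counit_gl g) -counitM antipode_gll counit1.
have gr : (gl_val g ⊗ gl_val g : H ⊗ H) *
    (antipode (gl_val g) ⊗ antipode (gl_val g)) = 1.
  by rewrite tpureM antipode_glr.
by rewrite -[LHS]mulr1 -gr mulrA -comul_gl -comulM antipode_gll comul1 mul1r.
Qed.

Definition gl_mul g1 g2 := Grouplike (gl_mul_subproof g1 g2).
Definition gl_one := Grouplike gl_one_subproof.
Definition gl_inv g := Grouplike (gl_inv_subproof g).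

Fact gl_mulA : associative gl_mul.
Proof. by move=> g1 g2 g3; apply/val_inj/mulrA. Qed.
Fact gl_mul1 : left_id gl_one gl_mul.
Proof. by move=> g; apply/val_inj/mul1r. Qed.
Fact gl_1mul : right_id gl_one gl_mul.
Proof. by move=> g; apply/val_inj/mulr1. Qed.
Fact gl_mulV : left_inverse gl_one gl_inv gl_mul.
Proof. by move=> g; apply/val_inj/antipode_gll. Qed.
Fact gl_mulVr : right_inverse gl_one gl_inv gl_mul.
Proof. by move=> g; apply/val_inj/antipode_glr. Qed.

HB.instance Definition _ := isGroup.Build grouplike
  gl_mulA gl_mul1 gl_1mul gl_mulV gl_mulVr.

End Grouplike.

Section FinSubgroup.
Variable G : groupType.

Record finSubgroup : Type := FinSubgroup {
  fsg_set :> {fset G};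
  fsg_closed : group_closed [in fsg_set]
}.

Variable P : finSubgroup.
HB.instance Definition _ :=
  SubChoice_isSubGroup.Build G _ (fset_sub_type P) (fsg_closed P).

End FinSubgroup.

Section PseudoPrimitive.
Variables (R : comNzRingType) (H : hopfAlgType R).
Variable P : finSubgroup (weight H).

Definition Sigma (T : {set P}) (x : H) : R :=
  \sum_(l in T) (val l : weight H) x.

Definition pseudo_primitive (h : H) (g g' : grouplike H) : Prop :=
  comul h = gl_val g ⊗ h + h ⊗ gl_val g' /\
  forall l : P, (val l : weight H) (gl_val (g^-1 * g')%g) = 1.

(* T consists of exactly one lift of each class in the abelianization that   *)
(* belongs to C.                                                             *)
Definition lift_set (C : {set coset_of [set: P]^`(1)}) (T : {set P}) : Prop :=
  coset [set: P]^`(1) @: T = C /\ {in T &, injective (coset [set: P]^`(1))}.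

End PseudoPrimitive.

(* Main.v *)
(* Restricted to the finite group Pi of weights, evaluation at g_i is a       *)
(* multiplicative character chi_i and evaluation at h_i is a map d_i with     *)
(*   d_i (x y) = chi_i x * d_i y + d_i x * chi_i y,                           *)
(* so d_i / chi_i is additive with values in a domain of characteristic p.    *)
(* Hence (chi_i, d_i) is (1, 0) on commutators and on p-th powers of          *)
(* p-elements, chi_i is 1 on p-elements, and d_i vanishes on every x having a *)
(* power of exponent prime to p in [Pi, Pi].  In cases (b) and (c) some y in  *)
(* Pi_p of order p has (chi_i, d_i) y = (1, 0) for all i: the summand is then *)
(* constant on left cosets of <y>, and the sum is a multiple of p.            *)
(* Otherwise Pi is in bijection with T x [Pi, Pi] x Pi_p, where T lifts Phi', *)
(* and d_i (t x y) = chi_i t * d_i y factors the sum.                         *)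

Require Import Defs.
From mathcomp Require Import all_boot all_algebra all_fingroup all_solvable.
From mathcomp Require Import finmap.
From mathcomp Require Import mxabelem ring.

Set Implicit Arguments.
Unset Strict Implicit.
Unset Printing Implicit Defensive.

Import GRing.Theory.
Local Open Scope ring_scope.

(** Equivalently, each h_i gives a homomorphism x -> chi_i x + d_i x e from Pi to the units of the
    dual numbers R[e]/(e^2) ([weight_pseudo_primitive]). The target is commutative, so [Pi, Pi] lies
    in the kernel ([der1_sub_twisted_ker]), and characteristic p puts p-th powers of p-elements
    there too ([twisted_ker_expgp]). Case (a) is then [sum_twisted_p'group], cases (b) and (c) are
    [sum_twisted_ker], and the product formula is [sum_twisted_lifts]. *)

(** * Group theory: elementary abelian groups and Sylow subgroups of abelian quotients *)

(** If x had order p^(e+2), its power x^(p^e) would have order p^2. *)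
Lemma abelem_no_order_p2 (gT : finGroupType) (p : nat) (E : {group gT}) :
    prime p -> (p.-group E)%g -> abelian E ->
    (forall x, x \in E -> #[x]%g <> (p ^ 2)%N) -> (p.-abelem E)%g.
Proof.
move=> p_pr pE cEE noE; rewrite abelemE // cEE; apply/exponentP => x Ex.
have [[|[|e]] ox] := p_natP (mem_p_elt pE Ex).
- by move/eqP: ox; rewrite order_eq1 => /eqP->; rewrite expg1n.
- by rewrite -[p]expn1 -ox expg_order.
case: (noE (x ^+ (p ^ e))%g); first exact: groupX.
by rewrite (orderXexp e ox) -addn2 addKn.
Qed.

Lemma isog_abelem_Zp (gT : finGroupType) (p : nat) (E : {group gT}) :
    prime p -> (p.-abelem E)%g -> E != 1%g :> {set gT} ->
  exists2 k, (0 < k)%N & (E \isog [set: 'rV['Z_p]_k])%g.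
Proof.
move=> p_pr abE ntE; exists (logn p #|E|).
  rewrite logn_gt0 mem_primes p_pr cardG_gt0.
  by case: (pgroup_pdiv (abelem_pgroup abE) ntE).
rewrite -(dim_abelemE abE ntE).
(* ['F_p] is built from [pdiv p], which is p since p is prime. *)
by have := isog_abelem_rV abE ntE; rewrite {1 2}/Zp_trunc (pdiv_id p_pr).
Qed.

(** The image of a Sylow subgroup is Sylow, and an abelian group has only one p-Sylow subgroup, its
    p-core. *)
Lemma quotient_Sylow_eq (gT : finGroupType) (p : nat) (G D S : {group gT})
    (Q : {group coset_of D}) :
    (D <| G)%g -> abelian (G / D)%g ->
    (p.-Sylow(G) S)%g -> (p.-Sylow(G / D) Q)%g ->
  (S / D)%g = Q.
Proof.
move=> nDG cGD sylS sylQ.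
have nDS := subset_trans (pHall_sub sylS) (normal_norm nDG).
have hallO := nilpotent_pcore_Hall p (abelian_nil cGD).
rewrite (eq_Hall_pcore hallO sylQ).
exact: eq_Hall_pcore hallO (quotient_pHall nDS sylS).
Qed.

(** * Maps x -> chi x + d x e into the dual numbers *)

Section TwistedAdditive.
Variables (gT : finGroupType) (R : idomainType).

Definition twisted_additive (chi d : gT -> R) : Prop :=
  [/\ chi 1%g = 1, {morph chi : x y / (x * y)%g >-> x * y}
    & forall x y, d (x * y)%g = chi x * d y + d x * chi y].

Section Theory.
Variables chi d : gT -> R.
Hypothesis chi_d : twisted_additive chi d.

Let chi1 : chi 1%g = 1. Proof. by case: chi_d. Qed.
Let chiM : {morph chi : x y / (x * y)%g >-> x * y}. Proof. by case: chi_d. Qed.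
Let dM x y : d (x * y)%g = chi x * d y + d x * chi y.
Proof. by case: chi_d. Qed.

Lemma twisted_additive1 : d 1%g = 0.
Proof.
have := dM 1 1; rewrite mulg1 chi1 mul1r mulr1 => /eqP.
by rewrite -subr_eq0 opprD addNKr oppr_eq0 => /eqP.
Qed.

Lemma character_neq0 x : chi x != 0.
Proof.
apply/eqP => chix0; have := chiM x x^-1%g.
by rewrite mulgV chi1 chix0 mul0r => /eqP; rewrite oner_eq0.
Qed.

Lemma characterX x m : chi (x ^+ m)%g = chi x ^+ m.
Proof. by elim: m => [|m IHm]; rewrite ?expg0 // expgS exprS chiM IHm. Qed.

(** The exponent is written [m.+1] so that the power of [chi x] is m, with no truncated
    predecessor. *)
Lemma twisted_additiveX x m :
  d (x ^+ m.+1)%g = m.+1%:R * chi x ^+ m * d x.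
Proof.
elim: m => [|m IHm]; first by rewrite expg1 mul1r mul1r.
rewrite expgS dM IHm characterX exprS [m.+2%:R]mulrS; ring.
Qed.

(** The kernel of x -> chi x + d x e. *)
Definition twisted_ker : {set gT} := [set x | (chi x == 1) && (d x == 0)].

Lemma twisted_kerP x : reflect (chi x = 1 /\ d x = 0) (x \in twisted_ker).
Proof.
by rewrite inE; apply: (iffP andP) => -[/eqP-> /eqP->]; rewrite ?eqxx.
Qed.

Lemma twisted_ker_group_set : group_set twisted_ker.
Proof.
apply/group_setP; split=> [|x y].
  exact/twisted_kerP/(conj chi1 twisted_additive1).
move=> /twisted_kerP[cx dx] /twisted_kerP[cy dy]; apply/twisted_kerP.
by rewrite chiM dM cx cy dx dy !(mul1r, mulr0, mul0r, addr0).
Qed.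
Canonical twisted_ker_group := Group twisted_ker_group_set.

Lemma der1_sub_twisted_ker (A : {set gT}) : (A^`(1))%g \subset twisted_ker.
Proof.
rewrite derg1 gen_subG; apply/subsetP => _ /imset2P[x y _ _ ->].
(* As y x [x, y] = x y, both values at [x, y] follow by cancelling the nonzero factor
   [chi (y * x)]. *)
have cxy : chi (y * x)%g != 0 by exact: character_neq0.
have cR : chi [~ x, y]%g = 1.
  by apply: (mulfI cxy); rewrite -chiM mulr1 -commgC !chiM mulrC.
apply/twisted_kerP; split=> //; apply: (mulfI cxy); rewrite mulr0.
apply: (addIr (d (y * x)%g)); rewrite add0r.
have := dM (y * x)%g [~ x, y]%g; rewrite -commgC cR mulr1 => <-.
by rewrite !dM addrC mulrC [d y * _]mulrC.
Qed.

Section PositiveCharacteristic.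
Variable p : nat.
Hypothesis charRp : p \in [pchar R].

(** Frobenius: if q is the order of x, a power of p, then (chi x - 1)^q = (chi x)^q - 1 = 0 in a
    domain. *)
Lemma character_p_elt x : (p.-elt x)%g -> chi x = 1.
Proof.
move=> px; have pnat_ox : [pchar R].-nat #[x]%g.
  by rewrite (eq_pnat _ (pcharf_eq charRp)).
have := exprDn_pchar (chi x - 1) 1 pnat_ox.
rewrite subrK expr1n -characterX expg_order chi1 -[X in X = _]add0r.
move/addIr/esym/eqP.
by rewrite expf_eq0 order_gt0 subr_eq0 => /eqP.
Qed.

(** The factor m (chi x)^(m-1) relating the two values of [d] is nonzero in R. *)
Lemma twisted_additive_eq0X x m :
  ~~ (p %| m)%N -> d (x ^+ m)%g = 0 -> d x = 0.
Proof.
case: m => [|m]; rewrite ?dvdn0 // (dvdn_pcharf charRp) => m_neq0.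
rewrite twisted_additiveX => /eqP; rewrite !mulf_eq0 (negPf m_neq0).
by rewrite (negPf (expf_neq0 _ (character_neq0 x))) => /eqP.
Qed.

Lemma twisted_ker_expgp x : (p.-elt x)%g -> (x ^+ p)%g \in twisted_ker.
Proof.
move=> px; apply/twisted_kerP; rewrite character_p_elt ?p_eltX //.
case: p charRp (pcharf0 charRp) => [|q] charRq q0.
  by have := pcharf_prime charRq.
by rewrite twisted_additiveX q0 !mul0r.
Qed.

End PositiveCharacteristic.

End Theory.

(** * Summing products of the d_i over the group *)

Lemma sum_cycle_invariant (y : gT) (F : gT -> R) :
  (forall x, F (x * y)%g = F x) -> #[y]%g%:R = 0 :> R -> \sum_x F x = 0.
Proof.
move=> Fy oy0; rewrite (partition_big (fun x => (x *: <[y]>)%g) predT) //=.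
apply: big1 => C _.
have [x0 /eqP <-|noC] := pickP (fun x => (x *: <[y]>)%g == C); last first.
  by rewrite big_pred0.
have FY i x : F (x * y ^+ i)%g = F x.
  by elim: i => [|i IHi]; rewrite ?mulg1 // expgSr mulgA Fy.
rewrite (eq_bigr (fun=> F x0)) => [|x /eqP xY].
  rewrite sumr_const (eq_card (B := (x0 *: <[y]>)%g)) ?card_lcoset.
    by rewrite -mulr_natr -/(order y) oy0 mulr0.
  by move=> x; rewrite [LHS]unfold_in; apply: (sameP eqP lcoset_eqP).
have: x \in (x0 *: <[y]>)%g by rewrite -xY lcoset_refl.
by case/lcosetP=> _ /cycleP[i ->] ->; rewrite FY.
Qed.

Section Families.
Variables (p n : nat).
Hypotheses (charRp : p \in [pchar R]) (n_gt0 : (0 < n)%N).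
Variables chi d : 'I_n -> gT -> R.
Hypothesis chi_d : forall i, twisted_additive (chi i) (d i).

Lemma sum_twisted_p'group :
  (p^'.-group [set: gT])%g -> \sum_x \prod_(i < n) d i x = 0.
Proof.
(* Since n > 0 the product has a factor [d] to kill; an empty product would be 1. *)
move=> p'G; apply: big1 => x _; rewrite (bigD1 (Ordinal n_gt0)) //=.
set m := #|[set: gT]|.
rewrite [d _ x](twisted_additive_eq0X (chi_d _) charRp (m := m)) ?mul0r //.
  rewrite -p'natE ?(pcharf_prime charRp) //.
by rewrite expg_cardG ?inE // (twisted_additive1 (chi_d _)).
Qed.

Lemma sum_twisted_ker (y : gT) : #[y]%g = p ->
    (forall i, y \in twisted_ker (chi i) (d i)) ->
  \sum_x \prod_(i < n) d i x = 0.
Proof.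
move=> oy yK; apply: (@sum_cycle_invariant y) => [x|]; last first.
  by rewrite oy pcharf0.
apply: eq_bigr => i _; have /twisted_kerP[cy dy] := yK i.
by case: (chi_d i) => _ _ ->; rewrite cy dy mulr0 add0r mulr1.
Qed.

(** Each element of G is uniquely t x y with t in T, x in D and y in S; x contributes nothing and
    d_i t = 0, so d_i (t x y) = chi_i t * d_i y. *)
Lemma sum_twisted_lifts (G D S : {group gT}) (Q Q' : {group coset_of D})
    (T : {set gT}) :
    G :=: [set: gT] -> (D <| G)%g -> abelian (G / D)%g ->
    (forall i, D \subset twisted_ker (chi i) (d i)) ->
    (p.-Sylow(G) S)%g -> (S :&: D = 1)%g ->
    (p.-Sylow(G / D) Q)%g -> Q' \subset (G / D)%g ->
    #|Q'| = (#|G / D|%g %/ #|Q|)%N ->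
    coset D @: T = Q' -> {in T &, injective (coset D)} ->
  \sum_x \prod_(i < n) d i x =
    #|D|%:R * (\sum_(t in T) \prod_(i < n) chi i t) *
      \sum_(x in S) \prod_(i < n) d i x.
Proof.
move=> defG nDG cGD sDK sylS tiSD sylQ sQ'G oQ' imT injT.
have p_pr := pcharf_prime charRp.
have allN x : (x \in 'N(D))%g.
  by rewrite (subsetP (normal_norm nDG)) // defG inE.
have eQ := quotient_Sylow_eq nDG cGD sylS sylQ.
have oSQ : #|S| = #|Q|.
  rewrite -eQ; apply: card_isog; rewrite quotient_isog 1?setIC //.
  by apply/subsetP.
have oGD := partnC p (cardG_gt0 (G / D)).
have oQ'p : #|Q'| = ((#|(G / D)%g|)`_p^')%N.
  by rewrite oQ' (card_Hall sylQ) -[X in (X %/ _)%N]oGD mulKn.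
have p'Q' : ~~ (p %| #|Q'|)%N by rewrite -p'natE // oQ'p part_pnat.
have tiQ : (Q' :&: Q = 1)%g.
  apply: coprime_TIg; rewrite oQ'p (card_Hall sylQ) coprime_sym.
  exact: coprime_partC.
have TQ' t : t \in T -> coset D t \in Q' by move=> Tt; rewrite -imT imset_f.
have dT i t : t \in T -> d i t = 0.
  move=> Tt; apply: (twisted_additive_eq0X (chi_d i) charRp p'Q').
  have Dt : (t ^+ #|Q'|)%g \in D.
    by apply: coset_idr => //; rewrite morphX ?allN //= expg_cardG ?TQ'.
  by have /twisted_kerP[] := subsetP (sDK i) _ Dt.
pose A := setX (setX T D) S.
pose m (u : gT * gT * gT) := (u.1.1 * u.1.2 * u.2)%g.
have mA : {in A &, injective m}.
  move=> [[t1 x1] y1] [[t2 x2] y2] /=; rewrite !inE /=.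
  case/andP=> /andP[Tt1 Dx1] Sy1 /andP[/andP[Tt2 Dx2] Sy2]; rewrite /m /= => em.
  have SQ y : y \in S -> coset D y \in Q.
    by move=> Sy; rewrite -eQ mem_quotient.
  (* Modulo D the x's vanish, so the classes of t1 and t2 differ by an element of both Q' and Q,
     which meet trivially. *)
  have et : t1 = t2.
    apply: injT => //; have := congr1 (coset D) em.
    rewrite !(morphM, allN) ?groupM ?allN //=.
    rewrite !(coset_id Dx1, coset_id Dx2) !mulg1 => ec.
    apply/eqP; rewrite eq_mulVg1 -in_set1 -set1gE -tiQ inE.
    rewrite groupM ?groupV ?TQ' //=.
    suffices -> :
      ((coset D t1)^-1 * coset D t2 = coset D y1 * (coset D y2)^-1)%g.
      by rewrite groupM ?groupV ?SQ.
    apply: (mulgI (coset D t1)); apply: (mulIg (coset D y2)).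
    by rewrite mulKVg !mulgA ec mulgKV.
  move: em; rewrite et -!mulgA => /mulgI exy.
  have exy' : (x2^-1 * x1 = y2 * y1^-1)%g.
    by apply: (mulgI x2); apply: (mulIg y1); rewrite mulKVg !mulgA mulgKV exy.
  have : (x2^-1 * x1)%g \in S :&: D.
    by rewrite inE [X in _ && X]groupM ?groupV // andbT exy' groupM ?groupV.
  rewrite tiSD => /set1gP ex.
  have e1 : x1 = x2 by apply: (mulgI x2^-1%g); rewrite ex mulVg.
  by move: exy; rewrite e1 => /mulgI ->.
(* Surjectivity by counting: |T| |D| |S| = (|G / D| / |Q|) |D| |Q| = |G|. *)
have imA : m @: A = [set: gT].
  apply/eqP; rewrite eqEcard subsetT card_in_imset // !cardsX.
  rewrite -(card_in_imset injT) imT.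
  rewrite oSQ oQ' -defG -(Lagrange (normal_sub nDG)).
  rewrite -card_quotient ?normal_norm //.
  rewrite mulnAC divnK ?[(#|D| * _)%N]mulnC ?leqnn //.
  by rewrite cardSg // (pHall_sub sylQ).
transitivity (\sum_(x in m @: A) \prod_(i < n) d i x).
  by rewrite imA; apply: eq_bigl => x; rewrite inE.
rewrite big_imset //=; symmetry.
transitivity (\sum_(t in T) \sum_(x in D) \sum_(y in S)
   \prod_(i < n) d i (m (t, x, y))).
  rewrite -mulrA mulr_suml mulr_sumr; apply: eq_bigr => t Tt.
  rewrite mulr_natl -sumr_const; apply: eq_bigr => x Dx; rewrite mulr_sumr.
  apply: eq_bigr => y Sy; rewrite -big_split; apply: eq_bigr => i _ /=.
  have /twisted_kerP[cx dx] := subsetP (sDK i) x Dx.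
  case: (chi_d i) => _ cM dM; rewrite /m /= !dM !cM cx dx (dT i t Tt).
  by rewrite !(mulr0, mul0r, addr0, mulr1).
rewrite pair_big /= pair_big /=; apply: eq_big => [[[t x] y]|[[t x] y] _] //=.
by rewrite !inE.
Qed.

End Families.
End TwistedAdditive.

(** * From weights to twisted additive maps, and the theorem *)

Section Weights.
Variables (R : idomainType) (H : hopfAlgType R) (P : finSubgroup (weight H)).

(** The weights in Pi agree on g and g', so convolution applied to the coproduct of h is exactly the
    twisted Leibniz rule. *)
Lemma weight_pseudo_primitive (h : H) (g g' : grouplike H) :
    pseudo_primitive P h g g' ->
  twisted_additive (fun x : P => (val x : weight H) (gl_val g))
                   (fun x : P => (val x : weight H) h).
Proof.
case=> hE gg'.
have BW (l m : weight H) := scalar_bilinear (weight_scalar l) (weight_scalar m).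
have egg' (x : P) :
    (val x : weight H) (gl_val g') = (val x : weight H) (gl_val g).
  rewrite -[RHS]mulr1 -(gg' x) -rmorphM; congr (val x _).
  rewrite [gl_val (_ * _)%g]/(antipode (gl_val g) * gl_val g').
  by rewrite mulrA antipode_glr mul1r.
split=> [|x y|x y]; first exact: counit_gl.
  rewrite [LHS]/(conv _ _ _) /conv comul_gl; exact: (tliftE (BW _ _)).
rewrite [LHS]/(conv _ _ _) /conv hE (tlift_D (BW _ _)).
by rewrite !(tliftE (BW _ _)) egg'.
Qed.

Lemma Sigma_prod (T : {set P}) (n : nat) (h : 'I_n -> H) :
  Sigma T (\prod_(i < n) h i) =
  \sum_(x in T) \prod_(i < n) (val x : weight H) (h i).
Proof. by apply: eq_bigr => x _; rewrite rmorph_prod. Qed.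

End Weights.

Theorem theorem7p8 (R : idomainType) (p : nat) (hp : p \in [pchar R])
    (H : hopfAlgType R) (P : finSubgroup (weight H))
    (Pp : {group P}) (hPp : (p.-Sylow([set: P]) Pp)%g)
    (n : nat) (hn : (1 <= n)%N) (h : 'I_n -> H) (g g' : 'I_n -> grouplike H)
    (hh : forall i, pseudo_primitive P (h i) (g i) (g' i))
    (Phip Phi' : {group coset_of [set: P]^`(1)%g})
    (hPhip : (p.-Sylow([set: P] / [set: P]^`(1)) Phip)%g)
    (sPhi' : Phi' \subset ([set: P] / [set: P]^`(1))%g)
    (oPhi' : #|Phi'| = (#|([set: P] / [set: P]^`(1))%g| %/ #|Phip|)%N) :
  let hb : H := \prod_(i < n) h i in
  let gb : H := \prod_(i < n) gl_val (g i) in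
  let D := [set: P]^`(1)%g in
  let case_a := Pp = 1%g :> {set P} in
  let case_b := exists2 x, x \in Pp & #[x]%g = (p ^ 2)%N in
  let case_c := (Pp :&: D) != 1%g in
  [/\ (case_a \/ case_b \/ case_c -> Sigma [set: P] hb = 0),
      [/\ ~~ abelian Pp -> case_c,
          ~~ isom Pp Phip (coset D) -> case_c
        & (#|Phip| < #|Pp|)%N -> case_c]
    & ~ (case_a \/ case_b \/ case_c) ->
      [/\ (Pp \isog Phip)%g,
          exists2 k, (0 < k)%N & (Phip \isog [set: 'rV['Z_p]_k])%g
        & forall T : {set P}, lift_set Phi' T ->
            Sigma [set: P] hb = #|D|%:R * Sigma T gb * Sigma Pp hb]].
Proof.
move=> hb gb D case_a case_b case_c.
have p_pr := pcharf_prime hp; have pPp := pHall_pgroup hPp.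
have chi_d i := weight_pseudo_primitive (hh i).
have SG : Sigma [set: P] hb =
    \sum_(x : P) \prod_(i < n) (val x : weight H) (h i).
  by rewrite /hb Sigma_prod; apply: eq_bigl => x; rewrite inE.
pose G : {group P} := [set: P]%G; pose D1 : {group P} := (G^`(1))%G.
have nDG : (D1 <| G)%g := der_normal 1 G.
have cGD : abelian (G / D1)%g := der_abelian 0 G.
have sDK i := der1_sub_twisted_ker (chi_d i) G.
have eQ : (Pp / D1)%g = Phip :=
  @quotient_Sylow_eq _ p G D1 Pp Phip nDG cGD hPp hPhip.
have sPN : Pp \subset ('N(D1))%g.
  by apply: subset_trans (normal_norm nDG); apply: subsetT.
have isoPp : ~ case_c -> isom Pp Phip (coset D1).
  move/negP/negPn/eqP => ti; rewrite -eQ.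
  by apply: quotient_isom; rewrite 1?setIC.
have isogPp : ~ case_c -> (Pp \isog Phip)%g.
  by move/isoPp; apply: (@isom_isog _ _ _ _ _ (coset_morphism D1) sPN).
split.
- rewrite SG; case=> [Pp1|[[x Px ox]|ntI]].
  + apply: (sum_twisted_p'group hp hn chi_d).
    by rewrite /pgroup -partn_eq1 ?cardG_gt0 // -(card_Hall hPp) Pp1 cards1.
  + apply: (sum_twisted_ker hp chi_d (y := (x ^+ p)%g)) => [|i].
      by rewrite -[p in (x ^+ p)%g]expn1 (orderXexp 1 ox).
    by have := twisted_ker_expgp (chi_d i) hp (mem_p_elt pPp Px).
  + have pI : (p.-group (Pp :&: D))%g := pgroupS (subsetIl _ _) pPp.
    have [_ pdI _] := pgroup_pdiv pI ntI.
    have [y /setIP[_ Dy] oy] := Cauchy p_pr pdI.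
    apply: (sum_twisted_ker hp chi_d oy) => i.
    exact: subsetP (sDK i) y Dy.
- split.
  (* For (d): the derived subgroup of [Pp] lies in both [Pp] and [D]. *)
  + apply: contraR; rewrite negbK => /eqP ti; apply/derG1P/trivgP; rewrite -ti.
    by rewrite subsetI der_sub dergS ?subsetT.
  + by apply: contraR => /negP; exact: isoPp.
  + rewrite ltnNge; apply: contraR => /negP/isogPp isoP.
    by rewrite (card_isog isoP).
- move=> nabc; have isogP : (Pp \isog Phip)%g by apply: isogPp; tauto.
  have ti : (Pp :&: D = 1)%g by apply/eqP/negPn/negP; tauto.
  have abP : (p.-abelem Phip)%g.
    rewrite -(isog_abelem isogP); apply: abelem_no_order_p2 => // [|x Px ox].
      rewrite (isog_abelian isogP); apply: (abelianS (pHall_sub hPhip)).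
      exact: cGD.
    by apply: nabc; right; left; exists x.
  split=> //.
    (* A trivial [Phip] would force [Pp] to be trivial, which is case (a). *)
    apply: isog_abelem_Zp => //; apply/negP => P1; apply: nabc; left; apply/eqP.
    by rewrite (isog_eq1 isogP).
  move=> T [imT injT].
  rewrite SG /hb /gb !Sigma_prod.
  exact: (@sum_twisted_lifts _ _ p n hp _ _ chi_d G D1 Pp Phip Phi' T erefl nDG
    cGD sDK hPp ti hPhip sPhi' oPhi' imT injT).
Qed.
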